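(* Suppose $f,f_1,\dots,f_J$ satisfy the $\lambda$-smooth assumption (no convexity is assumed), and let $(\theta_k)_{k\ge0}$ be the SGD iterates with constant step-size $0<\eta<\frac{1}{2\lambda_{\max,0}}$. Define $$z_0=\frac{-2\eta\Lambda D_0+\sqrt{4\eta^2\Lambda^2D_0^2+8\eta\lambda_{\max,0}D_0^2}}{4\lambda_{\max,0}},$$ and assume $$\frac{\eta^2\Lambda D_0}{1-2\eta\lambda_{\max,0}}\le z_0 .$$ Then: (1) For every $k\ge0$, $R_k\ge\min\{R_0,z_0^2\}$. (2) For every $k\ge0$, if $R_k<z_0^2$, then $R_{k+1}>R_k$. (3) If there exists $k^*\ge 0$ such that $R_{k^*}\ge z_0^2$, then $R_k\ge z_0^2$ for all $k>k^*$.
   Context: Let $d,J\ge 1$, let $f_1,\dots,f_J:\mathbb{R}^d\to\mathbb{R}$ be differentiable, and let $f=\frac1J\sum_{j=1}^J f_j$. Let $\theta^\dagger\in\mathbb{R}^d$ be an optimal solution (global minimizer) of $\min_{\theta\in\mathbb{R}^d} f(\theta)$, assumed to exist; in particular $\nabla f(\theta^\dagger)=0$. $|\cdot|$ denotes the Euclidean norm. $\lambda$-smooth assumption: there are constants $\lambda_{\max,0},\lambda_{\max,1},\dots,\lambda_{\max,J}>0$ such that for all $\theta_1,\theta_2\in\mathbb{R}^d$: $|\nabla f(\theta_1)-\nabla f(\theta_2)|\le\lambda_{\max,0}|\theta_1-\theta_2|$ and $|\nabla f_j(\theta_1)-\nabla f_j(\theta_2)|\le\lambda_{\max,j}|\theta_1-\theta_2|$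 for every $j=1,\dots,J$. Notation: $D_0=\left(\frac1J\sum_{j=1}^J|\nabla f_j(\theta^\dagger)|^2\right)^{1/2}$ and $\Lambda=\left(\frac1J\sum_{j=1}^J\lambda_{\max,j}^2\right)^{1/2}$. SGD with constant step-size $\eta>0$: $\theta_{k+1}=\theta_k-\eta\nabla f_{\gamma_k}(\theta_k)$ for $k\ge 0$, where $\gamma_0,\gamma_1,\dots$ are i.i.d. uniform on $\{1,\dots,J\}$ and the initial point $\theta_0$ (possibly random) is independent of $(\gamma_k)_{k\ge0}$ with $\mathbb{E}|\theta_0-\theta^\dagger|^2<\infty$. The error is $R_k=\mathbb{E}|\theta_k-\theta^\dagger|^2$. *)

(* Defs.v *)
From HB Require Import structures.
From mathcomp Require Import all_boot all_order all_algebra.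
From mathcomp Require Import all_classical all_reals all_analysis.

Set Implicit Arguments.
Unset Strict Implicit.
Unset Printing Implicit Defensive.

Import Order.TTheory GRing.Theory Num.Theory.
Import numFieldNormedType.Exports.

Local Open Scope classical_set_scope.
Local Open Scope ring_scope.

Section Euclidean.
Context {R : realType} {n : nat}.

(* The library norm `|x| on 'rV[R]_n is the sup norm. Topology and
   differentiability do not depend on the choice, the constants below do. *)
Definition enorm (x : 'rV[R]_n) : R := Num.sqrt (\sum_(i < n) x 0 i ^+ 2).

Definition grad (g : 'rV[R]_n -> R) (x : 'rV[R]_n) : 'rV[R]_n :=
  \row_(i < n) 'D_(delta_mx 0 i) g x.

Definition lipschitz_grad (lam : R) (g : 'rV[R]_n -> R) : Prop :=
  forall x y, enorm (grad g x - grad g y) <= lam * enorm (x - y).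

Definition global_minimizer (g : 'rV[R]_n -> R) (x : 'rV[R]_n) : Prop :=
  forall y, g x <= g y.

Definition borel_rV : set (set 'rV[R]_n) := <<s [set A | open A] >>.

End Euclidean.

Section FiniteSum.
Context {R : realType} {n J : nat}.
Implicit Types (fs : 'I_J -> 'rV[R]_n -> R) (x : 'rV[R]_n).

Definition avg fs : 'rV[R]_n -> R :=
  fun x => J%:R^-1 * \sum_(j < J) fs j x.

Definition smooth_assumption fs (lam0 : R) (lam : 'I_J -> R) : Prop :=
  [/\ 0 < lam0, forall j, 0 < lam j,
      lipschitz_grad lam0 (avg fs) &
      forall j, lipschitz_grad (lam j) (fs j)].

Definition noise_level fs x : R :=
  Num.sqrt (J%:R^-1 * \sum_(j < J) enorm (grad (fs j) x) ^+ 2).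

Definition rms (lam : 'I_J -> R) : R :=
  Num.sqrt (J%:R^-1 * \sum_(j < J) lam j ^+ 2).

Fixpoint sgd {T : Type} fs (eta : R) (theta0 : T -> 'rV[R]_n)
    (gamma : nat -> T -> 'I_J) (k : nat) (w : T) : 'rV[R]_n :=
  if k is k'.+1 then
    let x := sgd fs eta theta0 gamma k' w in
    x - eta *: grad (fs (gamma k' w)) x
  else theta0 w.

End FiniteSum.

Definition z_zero {R : realType} (eta lam0 Lam D0 : R) : R :=
  (- 2 * eta * Lam * D0 +
     Num.sqrt (4 * eta ^+ 2 * Lam ^+ 2 * D0 ^+ 2 + 8 * eta * lam0 * D0 ^+ 2))
  / (4 * lam0).

Section Probability.
Context {disp : measure_display} {T : measurableType disp} {R : realType}.
Variable P : probability T R.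

(* [M] is a sigma-algebra on the target space [U]. *)
Definition sigma_of {U : Type} (X : T -> U) (M : set (set U)) :
  set (set T) := preimage_set_system setT X M.

Definition random_element {U : Type} (X : T -> U) (M : set (set U)) : Prop :=
  sigma_of X M `<=` measurable.

Definition mutually_independent {I : choiceType} (F : I -> set (set T)) : Prop :=
  forall (s : seq I) (E : I -> set T), uniq s ->
    (forall i, i \in s -> F i (E i)) ->
    P (\bigcap_(i in [set` s]) E i) = (\prod_(i <- s) P (E i))%E.

Definition independent (F G : set (set T)) : Prop :=
  forall A B, F A -> G B -> P (A `&` B) = (P A * P B)%E.

(* Finite sets carry the discrete sigma-algebra [setT]. *)
Definition iid_uniform {J : nat} (gamma : nat -> T -> 'I_J) : Prop :=
  [/\ forall k, random_element (gamma k) setT,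
      forall k j, P (gamma k @^-1` [set j]) = (J%:R^-1)%:E &
      mutually_independent (fun k => sigma_of (gamma k) setT)].

Definition sigma_seq {J : nat} (gamma : nat -> T -> 'I_J) : set (set T) :=
  <<s \bigcup_k sigma_of (gamma k) setT >>.

Definition mean_sq_error {n : nat} (theta : nat -> T -> 'rV[R]_n)
    (x : 'rV[R]_n) (k : nat) : \bar R :=
  'E_P[fun w => enorm (theta k w - x) ^+ 2].

End Probability.

(* Main.v *)
Require Import Defs.
From HB Require Import structures.
From mathcomp Require Import all_boot all_order all_algebra.
From mathcomp Require Import all_classical all_reals all_analysis.
From mathcomp Require Import measurable_realfun ring lra.

Import Order.TTheory GRing.Theory Num.Theory.
Import numFieldNormedType.Exports.

Local Open Scope classical_set_scope.
Local Open Scope ring_scope.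

(** Write [y = enorm (x - theta)] for the distance to the minimizer.  One step
    of the iteration replaces [y ^+ 2] by
    [y ^+ 2 - 2 * eta * dot (x - theta) g_j + eta ^+ 2 * enorm g_j ^+ 2] with
    [g_j] the gradient of the drawn summand.  Averaged over [j], the middle term
    only sees the gradient of the mean function, which vanishes at [theta], so
    it is at least [- 2 * eta * lam0 * y ^+ 2].  In the last term, [g_j] differs
    from its value at [theta] by at most [lam j * y], and the Cauchy-Schwarz
    inequality over [j] leaves at least
    [eta ^+ 2 * (D0 ^+ 2 - 2 * Lam * D0 * y)].  This lower bound is
    [sgd_step_mean_sq_lower].

    The index drawn at time [k] is independent of the state at time [k], so the
    expectation over it is the plain average over [j] ([integral_chain_step]).
    Together with [(E Y) ^+ 2 <= E (Y ^+ 2)] ([first_moment_bound]) this gives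
    [R_(k+1) >= h (sqrt R_k)] for the quadratic
    [h s = (1 - 2 * eta * lam0) * s ^+ 2 - 2 * eta ^+ 2 * Lam * D0 * s
    + eta ^+ 2 * D0 ^+ 2].  Its nonnegative fixed point, in the sense
    [h s = s ^+ 2], is [z0]; below [z0] one has [h s > s ^+ 2], and the
    assumption on [z0] says that [h] is nondecreasing from [z0] on
    ([quadratic_step]).  All three claims are read off from these two facts. *)

(** * Euclidean geometry of row vectors *)

Section EuclideanNorm.
Context {R : realType} {n : nat}.
Implicit Types (u v w : 'rV[R]_n).

Definition dot u v : R := \sum_(i < n) u 0 i * v 0 i.

(** Expanding the nonnegative sum of the [(A * b i - C * a i) ^+ 2] gives
    [A * (A * B - C ^+ 2)]. *)
Lemma sum_cauchy_schwarz {m : nat} (a b : 'I_m -> R) :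
  \sum_i a i * b i <=
  Num.sqrt (\sum_i a i ^+ 2) * Num.sqrt (\sum_i b i ^+ 2).
Proof.
set A := \sum_i a i ^+ 2; set B := \sum_i b i ^+ 2.
set C := \sum_i a i * b i.
have A0 : 0 <= A by apply: sumr_ge0 => i _; exact: sqr_ge0.
have disc : \sum_i (A * b i - C * a i) ^+ 2 = A * (A * B - C ^+ 2).
  transitivity (\sum_i (A ^+ 2 * b i ^+ 2 + (- 2 * A * C) * (a i * b i)
      + C ^+ 2 * a i ^+ 2)); first by apply: eq_bigr => i _; ring.
  by rewrite !big_split/= -!mulr_sumr -/A -/B -/C; ring.
have disc_ge0 : 0 <= A * (A * B - C ^+ 2).
  by rewrite -disc; apply: sumr_ge0 => i _; exact: sqr_ge0.
rewrite -sqrtrM//; apply: (le_trans (ler_norm _)).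
rewrite -sqrtr_sqr ler_wsqrtr//.
move: A0; rewrite le_eqVlt => /predU1P[A_eq0|A_gt0].
  have a0 i : a i = 0.
    apply/eqP; rewrite -sqrf_eq0; apply/eqP.
    by apply: (psumr_eq0P _ (esym A_eq0)) => // j _; exact: sqr_ge0.
  by rewrite -A_eq0 mul0r /C big1 ?expr0n// => i _; rewrite a0 mul0r.
by move: disc_ge0; rewrite pmulr_rge0// subr_ge0.
Qed.

Lemma enorm_ge0 u : 0 <= enorm u.
Proof. exact: sqrtr_ge0. Qed.

Lemma enorm0 : enorm (0 : 'rV[R]_n) = 0.
Proof. by rewrite /enorm big1 ?sqrtr0// => i _; rewrite mxE expr0n. Qed.

Lemma enorm_sq u : enorm u ^+ 2 = dot u u.
Proof.
rewrite sqr_sqrtr; last by apply: sumr_ge0 => i _; exact: sqr_ge0.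
by apply: eq_bigr => i _; rewrite expr2.
Qed.

Lemma enorm_sqB u v :
  enorm (u - v) ^+ 2 = enorm u ^+ 2 - 2 * dot u v + enorm v ^+ 2.
Proof.
rewrite !enorm_sq /dot mulr_sumr -sumrN -!big_split/=.
by apply: eq_bigr => i _; rewrite !mxE; ring.
Qed.

Lemma enormZ (c : R) u : 0 <= c -> enorm (c *: u) = c * enorm u.
Proof.
move=> c0; apply/eqP; rewrite -(eqrXn2 (n := 2)) ?mulr_ge0 ?enorm_ge0//.
rewrite exprMn !enorm_sq /dot mulr_sumr; apply/eqP/eq_bigr => i _.
by rewrite !mxE; ring.
Qed.

Lemma enormN u : enorm (- u) = enorm u.
Proof. by rewrite /enorm; under eq_bigr do rewrite mxE sqrrN. Qed.

Lemma dotNl u v : dot (- u) v = - dot u v.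
Proof. by rewrite /dot -sumrN; apply: eq_bigr => i _; rewrite mxE mulNr. Qed.

Lemma dotZr (c : R) u v : dot u (c *: v) = c * dot u v.
Proof. by rewrite /dot mulr_sumr; apply: eq_bigr => i _; rewrite mxE; ring. Qed.

Lemma dot_sumr {m : nat} u (v : 'I_m -> 'rV[R]_n) :
  dot u (\sum_j v j) = \sum_j dot u (v j).
Proof.
rewrite /dot exchange_big/=; apply: eq_bigr => i _.
by rewrite summxE mulr_sumr.
Qed.

Lemma normr_le_enorm u : `|u| <= enorm u.
Proof.
rewrite /Num.Def.normr/= mx_normrE.
apply: bigmax_le => [|[i j] _ /=]; first exact: enorm_ge0.
rewrite ord1 -sqrtr_sqr ler_wsqrtr// (bigD1 j)//= lerDl.
by apply: sumr_ge0 => k _; exact: sqr_ge0.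
Qed.

Lemma enorm_continuous : continuous (@enorm R n).
Proof.
move=> x; apply: (@continuous_comp _ _ _ (fun y : 'rV[R]_n => \sum_i y 0 i ^+ 2)
  Num.sqrt); last exact: sqrt_continuous.
apply: cvg_big => [||i _]; first exact: add_continuous.
  exact: nbhs_filter.
rewrite expr2; under eq_fun do rewrite expr2.
by apply: cvgM; [exact: nbhs_filter|exact: coord_continuous..].
Qed.

Lemma dot_le_enorm u v : dot u v <= enorm u * enorm v.
Proof. exact: sum_cauchy_schwarz. Qed.

Lemma dot_ge_enorm u v : - (enorm u * enorm v) <= dot u v.
Proof.
rewrite lerNl -dotNl; apply: le_trans (dot_le_enorm _ _) _.
by rewrite enormN.
Qed.
End EuclideanNorm.

(** The topology on row vectors comes from the sup norm, which the Euclidean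
    norm dominates; instead of a converse bound, continuity of the Euclidean
    norm is used on the right-hand side. *)
Lemma enorm_lipschitz_continuous {R : realType} {n m : nat}
    (h : 'rV[R]_n -> 'rV[R]_m) (L : R) :
  (forall x y, enorm (h x - h y) <= L * enorm (x - y)) -> continuous h.
Proof.
move=> hL x; apply/(cvgrPdist_lt (FF := nbhs_filter x)) => /= e e0.
have sub_cont : {for x, continuous (fun y : 'rV[R]_n => (x : 'rV[R]_n) - y)}.
  exact: (cvgB (FF := nbhs_filter x) (cvg_cst x) cvg_id).
have enorm_cvg := continuous_comp sub_cont (enorm_continuous _).
have bound_cvg := cvgMr (FF := nbhs_filter x) (a := L) enorm_cvg.
have : \forall y \near x, L * enorm (x - y) < e 
  by apply: (cvgr_lt (FF := nbhs_filter x) _ bound_cvg); rewrite /= subrr enorm0 mulr0.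
apply: filterS => y; apply: le_lt_trans.
exact: le_trans (normr_le_enorm _) (hL x y).
Qed.

(** * Gradients *)

Section Gradients.
Context {R : realType} {d J : nat}.
Variable fs : 'I_J -> 'rV[R]_d -> R.
Hypothesis fs_diff : forall j x, differentiable (fs j) x.

Lemma avgE : avg fs = J%:R^-1 \*: (\sum_(j < J) fs j).
Proof. by apply/funext => x; rewrite /avg /= fct_sumE. Qed.

Lemma avg_differentiable x : differentiable (avg fs) x.
Proof. by rewrite avgE; apply/differentiableZ/differentiable_sum. Qed.

Lemma grad_avg x : grad (avg fs) x = J%:R^-1 *: \sum_j grad (fs j) x.
Proof.
apply/rowP => i; rewrite !mxE summxE avgE.
rewrite deriveZ; last by apply: derivable_sum => j; exact: diff_derivable.
rewrite derive_sum; last by move=> j; exact: diff_derivable.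
by congr (_ * _); apply: eq_bigr => j _; rewrite mxE.
Qed.
End Gradients.

(** Each partial derivative is the derivative at [0] of the restriction of [g]
    to a coordinate line, which is minimal there. *)
Lemma grad_global_minimizer {R : realType} {d : nat} (g : 'rV[R]_d -> R) x :
  (forall y, differentiable g y) -> global_minimizer g x -> grad g x = 0.
Proof.
move=> dg xmin; apply/rowP => i; rewrite !mxE.
pose v : 'rV[R]_d := delta_mx 0 i.
pose l (t : R) := g (t *: v + x).
have dl t : derivable l t 1.
  apply/derivable1_diffP; apply: (@differentiable_comp _ _ _ _
    (fun t : R => t *: v + x)) => //.
have l_min : is_derive (0 : R) 1 l 0.
  apply: (@derive1_at_min _ _ (-1) 1) => //.
  - by rewrite in_itv/=; lra.
  - by move=> t _; rewrite /l scale0r add0r; exact: xmin.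
rewrite -(@derive_val _ _ _ _ _ _ _ l_min) /derive.
set q := fun h => h^-1 *: _; set p := fun h => h^-1 *: _.
suff -> : q = p by [].
apply/funext => h; rewrite /q /p /l /=.
by rewrite scale0r add0r addr0 [_%:A]mulr1.
Qed.

(** * One step of the iteration, averaged over the drawn index *)

Definition sgd_step {R : realType} {d J : nat} (fs : 'I_J -> 'rV[R]_d -> R)
  (eta : R) (j : 'I_J) (x : 'rV[R]_d) := x - eta *: grad (fs j) x.

Section OneStep.
Context {R : realType} {d J : nat}.
Variables (fs : 'I_J -> 'rV[R]_d -> R) (theta : 'rV[R]_d).
Variables (lam0 : R) (lam : 'I_J -> R) (eta : R).
Hypothesis J_gt0 : (0 < J)%N.
Hypothesis fs_diff : forall j x, differentiable (fs j) x.
Hypothesis opt : global_minimizer (avg fs) theta.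
Hypothesis smooth : smooth_assumption fs lam0 lam.
Hypothesis eta_ge0 : 0 <= eta.

Let v j := grad (fs j) theta.

(** The gradient is its value at [theta] plus an increment controlled by the
    Lipschitz constant; the square of the increment is dropped. *)
Lemma grad_sq_lower j x :
  - (2 * enorm (x - theta) * (lam j * enorm (v j))) + enorm (v j) ^+ 2
  <= enorm (grad (fs j) x) ^+ 2.
Proof.
case: smooth => _ _ _ /(_ j x theta) lip.
set u := grad (fs j) x - v j in lip *.
have -> : grad (fs j) x = u - (- v j) by rewrite opprK subrK.
rewrite enorm_sqB enormN.
have := dot_le_enorm u (- v j); rewrite enormN.
have := ler_wpM2r (enorm_ge0 (v j)) lip.
by have := sqr_ge0 (enorm u); nra.
Qed.

Lemma sgd_step_sqE j x : enorm (sgd_step fs eta j x - theta) ^+ 2 =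
  enorm (x - theta) ^+ 2 - 2 * eta * dot (x - theta) (grad (fs j) x)
  + eta ^+ 2 * enorm (grad (fs j) x) ^+ 2.
Proof.
rewrite /sgd_step (addrAC x) (enorm_sqB (x - theta)) dotZr enormZ// exprMn.
by congr (_ - _ + _); ring.
Qed.

(** Serves only to propagate finiteness of second moments, hence the crude
    constants. *)
Lemma sgd_step_sq_upper j x : enorm (sgd_step fs eta j x - theta) ^+ 2 <=
  (2 + 4 * eta ^+ 2 * lam j ^+ 2) * enorm (x - theta) ^+ 2
  + 4 * eta ^+ 2 * enorm (v j) ^+ 2.
Proof.
case: smooth => _ lam_gt0 _ /(_ j x theta) lip.
set g := grad (fs j) x in lip *.
have g_sq : enorm g ^+ 2
    <= 2 * (lam j ^+ 2 * enorm (x - theta) ^+ 2) + 2 * enorm (v j) ^+ 2.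
  have -> : g = (g - v j) - (- v j) by rewrite opprK subrK.
  have u_sq : enorm (g - v j) ^+ 2 <= lam j ^+ 2 * enorm (x - theta) ^+ 2.
    by rewrite -exprMn lerXn2r ?nnegrE ?mulr_ge0 ?enorm_ge0// ltW.
  rewrite enorm_sqB enormN.
  have := dot_ge_enorm (g - v j) (- v j); rewrite enormN.
  by have := sqr_ge0 (enorm (g - v j) - enorm (v j)); nra.
rewrite sgd_step_sqE -/g.
have := ler_wpM2l (sqr_ge0 eta) g_sq.
have := ler_wpM2l eta_ge0 (dot_ge_enorm (x - theta) g).
have := sqr_ge0 (enorm (x - theta) - eta * enorm g).
by rewrite sqrrB exprMn; nra.
Qed.

Lemma lam_noise_le :
  J%:R^-1 * \sum_j lam j * enorm (v j) <= rms lam * noise_level fs theta.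
Proof.
have JV_ge0 : 0 <= J%:R^-1 :> R by rewrite invr_ge0.
rewrite /rms /noise_level !sqrtrM// mulrACA -expr2 sqr_sqrtr//.
by rewrite ler_wpM2l// sum_cauchy_schwarz.
Qed.

Lemma noise_level_sq :
  noise_level fs theta ^+ 2 = J%:R^-1 * \sum_j enorm (v j) ^+ 2.
Proof.
by rewrite sqr_sqrtr// mulr_ge0 ?invr_ge0// sumr_ge0// => j _; exact: sqr_ge0.
Qed.

(** Averaging over [j] before estimating is what brings in the constant [lam0]
    of the mean function: the inner product is linear in the gradient. *)
Lemma sgd_step_mean_sq_lower x (y := enorm (x - theta)) :
  (1 - 2 * eta * lam0) * y ^+ 2
    - 2 * eta ^+ 2 * rms lam * noise_level fs theta * y
    + eta ^+ 2 * noise_level fs theta ^+ 2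
  <= J%:R^-1 * \sum_j enorm (sgd_step fs eta j x - theta) ^+ 2.
Proof.
case: (smooth) => _ _ lip0 _.
have y_ge0 : 0 <= y by exact: enorm_ge0.
have JV_ge0 : 0 <= J%:R^-1 :> R by rewrite invr_ge0.
have -> : J%:R^-1 * \sum_j enorm (sgd_step fs eta j x - theta) ^+ 2 = y ^+ 2
    - 2 * eta * dot (x - theta) (J%:R^-1 *: \sum_j grad (fs j) x)
    + eta ^+ 2 * (J%:R^-1 * \sum_j enorm (grad (fs j) x) ^+ 2).
  under eq_bigr do rewrite sgd_step_sqE.
  rewrite !big_split/= sumrN -!mulr_sumr sumr_const card_ord -/y.
  rewrite -dot_sumr dotZr -(mulr_natr y).
  by field; rewrite pnatr_eq0 -lt0n.
have drift : dot (x - theta) (J%:R^-1 *: \sum_j grad (fs j) x) <= lam0 * y ^+ 2.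
  rewrite -grad_avg//; apply: le_trans (dot_le_enorm _ _) _.
  have := lip0 x theta.
  rewrite (grad_global_minimizer _ _ (avg_differentiable fs fs_diff) opt) subr0 => lip.
  by have := ler_wpM2l y_ge0 lip; rewrite -/y; nra.
have noise : - (2 * y * (rms lam * noise_level fs theta))
    + noise_level fs theta ^+ 2
    <= J%:R^-1 * \sum_j enorm (grad (fs j) x) ^+ 2.
  apply: (@le_trans _ _ (J%:R^-1 * \sum_j
    (- (2 * y * (lam j * enorm (v j))) + enorm (v j) ^+ 2))).
    rewrite big_split/= sumrN -mulr_sumr mulrDr -noise_level_sq lerD2r.
    rewrite mulrN lerN2 mulrCA ler_wpM2l ?mulr_ge0//; exact: lam_noise_le.
  by rewrite ler_wpM2l// ler_sum// => j _; exact: grad_sq_lower.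
have := ler_wpM2l eta_ge0 drift.
have := ler_wpM2l (sqr_ge0 eta) noise.
nra.
Qed.
End OneStep.

(** * Integrals over independent events *)

Section IndependentEvent.
Context {disp : measure_display} {T : measurableType disp} {R : realType}.
Variable P : probability T R.

(** Leaving [0] out of the domain of the law lets two laws that differ only
    there be compared. *)
Lemma integral_pushforward_pos (k : {mfun T >-> R}) :
  (forall w, 0 <= k w) ->
  (\int[P]_w (k w)%:E = \int[pushforward P k]_(y in `]0%R, +oo[) y%:E)%E.
Proof.
move=> k_ge0; rewrite (@ge0_integral_pushforward _ _ _ _ _ k)//=; last first.
  by move=> y; rewrite inE/= in_itv/= andbT lee_fin => /ltW.
rewrite [RHS]integral_mkcond; apply: eq_integral => w _.
rewrite patchE; case: ifPn => //; rewrite notin_setE/= in_itv/= andbT => /negP.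
by rewrite -leNgt => k_le0; congr EFin; apply/eqP; rewrite eq_le k_le0 k_ge0.
Qed.

(** The truncation of [h] to [A] and [h] itself have proportional laws away
    from [0], and the value [0] contributes nothing to an integral. *)
Lemma integral_independent_event (A : set T) (c : R) (h : T -> R) :
  measurable A -> 0 <= c -> measurable_fun setT h -> (forall w, 0 <= h w) ->
  (forall B, measurable B -> P (h @^-1` B `&` A) = P (h @^-1` B) * c%:E)%E ->
  (\int[P]_(w in A) (h w)%:E = c%:E * \int[P]_w (h w)%:E)%E.
Proof.
move=> mA c_ge0 mh h_ge0 indep.
have mhA : measurable_fun setT (h \_ A).
  apply/(measurable_restrictT _ mA).
  exact: (measurable_funS measurableT (@subsetT _ _) mh).
pose hm : {mfun T >-> R} := HB.pack h (isMeasurableFun.Build _ _ _ _ h mh).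
pose hAm : {mfun T >-> R} :=
  HB.pack (h \_ A) (isMeasurableFun.Build _ _ _ _ (h \_ A) mhA).
have -> : (\int[P]_(w in A) (h w)%:E = \int[P]_w (hAm w)%:E)%E.
  rewrite integral_mkcond; apply: eq_integral => w _ /=.
  by rewrite !patchE; case: ifP.
rewrite (integral_pushforward_pos hAm); last first.
  by move=> w /=; rewrite patchE; case: ifP.
rewrite -[in RHS](_ : \int[P]_w (hm w)%:E = \int[P]_w (h w)%:E)%E//.
rewrite (integral_pushforward_pos hm)//.
have -> : c = (NngNum c_ge0)%:num by [].
rewrite -ge0_integral_mscale//; last first.
  by move=> y /=; rewrite in_itv/= andbT lee_fin => /ltW.
apply: eq_measure_integral => B mB B_pos.
transitivity (P (h @^-1` B `&` A)); last by rewrite indep// muleC.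
congr (P _).
apply/seteqP; split => w /=; rewrite patchE; case: ifPn => // [/set_mem Aw|].
- by [].
- by move=> _ /B_pos/=; rewrite in_itv/= ltxx.
- by case.
- by rewrite notin_setE => nAw [].
Qed.
End IndependentEvent.

(** * A chain driven by independent uniform indices *)

Section DrivenChain.
Context {disp : measure_display} {T : measurableType disp} {R : realType}.
Variable P : probability T R.
Context {U : Type} {J : nat}.
Variables (M : set (set U)) (G : 'I_J -> U -> U).
Variables (X : nat -> T -> U) (gamma : nat -> T -> 'I_J).
Hypothesis M_preimage : forall j B, M B -> M (G j @^-1` B).
Hypothesis X_meas : random_element (X 0%N) M.
Hypothesis X_step : forall k w, X k.+1 w = G (gamma k w) (X k w).
Hypothesis gamma_iid : iid_uniform P gamma.
Hypothesis X_indep : independent P (sigma_of (X 0%N) M) (sigma_seq gamma).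

(** A recursion on the word, so that one draw peels off its first letter. *)
Fixpoint index_cylinder (k : nat) (s : seq 'I_J) : set T :=
  if s is j :: s' then gamma k @^-1` [set j] `&` index_cylinder k.+1 s'
  else setT.

Lemma index_cylinder_sigma k s : sigma_seq gamma (index_cylinder k s).
Proof.
rewrite /sigma_seq; set F := \bigcup_k _.
elim: s k => [|j s IH] k /=.
  exact: (@measurableT _ (g_sigma_algebraType F)).
apply: (@measurableI _ (g_sigma_algebraType F)); last exact: IH.
by apply: sub_sigma_algebra; exists k => //; exists [set j] => //; rewrite setTI.
Qed.

Lemma index_measurable k D : measurable (gamma k @^-1` D).
Proof.
by case: gamma_iid => /(_ k) + _ _; apply; exists D => //; rewrite setTI.
Qed.

Lemma index_cylinder_measurable k s : measurable (index_cylinder k s).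
Proof.
elim: s k => [|j s IH] k /=; first exact: measurableT.
by apply: measurableI => //; exact: index_measurable.
Qed.

(** The intersection form is the one to which mutual independence applies; the
    indices [i - k] stay below [size s], so the default [j0] is never read. *)
Lemma index_cylinderE j0 k s : index_cylinder k s =
  \bigcap_(i in [set` iota k (size s)]) (gamma i @^-1` [set nth j0 s (i - k)]).
Proof.
rewrite bigcap_seq.
elim: s k => [|j s IH] k /=; first by rewrite big_nil.
rewrite big_cons subnn IH; congr (_ `&` _).
apply: eq_big_seq => i; rewrite mem_iota => /andP[ki _].
by rewrite -(subnSK ki).
Qed.

Lemma index_cylinder_prob k s :
  P (index_cylinder k s) = (J%:R^-1 ^+ size s)%:E.
Proof.
case: gamma_iid => _ gamma_unif gamma_indep.
case: s => [|j0 s]; first by rewrite probability_setT.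
rewrite (index_cylinderE j0) gamma_indep ?iota_uniq//; last first.
  by move=> i _; eexists; last by rewrite setTI.
under eq_bigr do rewrite gamma_unif.
rewrite prodEFin; congr EFin.
by rewrite big_const_seq count_predT size_iota iter_mulr_1.
Qed.

Lemma index_partition (A : set T) k :
  A = \big[setU/set0]_(j < J) (A `&` gamma k @^-1` [set j]).
Proof.
rewrite -bigcup_seq; apply/seteqP; split => [w Aw|w [j _ []]//].
by exists (gamma k w) => //=; exact: mem_index_enum.
Qed.

Lemma index_trivIset (A : set T) k D :
  trivIset D (fun j => A `&` gamma k @^-1` [set j]).
Proof. by move=> i j _ _ [w [[_ <-] [_ <-]]]. Qed.

Lemma prob_index_partition (A : set T) k : measurable A ->
  P A = (\sum_(j < J) P (A `&` gamma k @^-1` [set j]))%E.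
Proof.
move=> mA; rewrite [in LHS](index_partition A k).
apply: measure_semi_additive_ord.
- by move=> j; apply: measurableI => //; exact: index_measurable.
- exact: index_trivIset.
- by rewrite -index_partition.
Qed.

Lemma state_measurable k B : M B -> measurable (X k @^-1` B).
Proof.
elim: k B => [|k IH] B MB.
  by apply: X_meas; exists B => //; rewrite setTI.
rewrite (index_partition (_ @^-1` B) k); apply: bigsetU_measurable => j _.
rewrite (_ : _ `&` _ =
    X k @^-1` (G j @^-1` B) `&` gamma k @^-1` [set j]); last first.
  by apply/seteqP; split => w [] /= + gj; rewrite X_step gj.
apply: measurableI; last exact: index_measurable.
exact/IH/M_preimage.
Qed.

(** Splitting according to [gamma k] turns a cylinder of indices from time
    [k.+1] into the cylinders from time [k] with one more letter; quantifying
    over all words is what lets the induction on [k] go through. *)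
Lemma state_cylinder_independent k B s : M B ->
  (P (X k @^-1` B `&` index_cylinder k s) =
   P (X k @^-1` B) * (J%:R^-1 ^+ size s)%:E)%E.
Proof.
elim: k B s => [|k IH] B s MB.
  rewrite X_indep ?index_cylinder_prob//; last exact: index_cylinder_sigma.
  by exists B => //; rewrite setTI.
have splitE u : P (X k.+1 @^-1` B `&` index_cylinder k.+1 u) =
    (\sum_(j < J) P (X k @^-1` (G j @^-1` B)) * (J%:R^-1 ^+ (size u).+1)%:E)%E.
  rewrite (@prob_index_partition _ k); last first.
    apply: measurableI; last exact: index_cylinder_measurable.
    exact: state_measurable.
  apply: eq_bigr => j _; rewrite -(IH _ (j :: u)); last exact: M_preimage.
  congr (P _); apply/seteqP; split => w /=.
    by move=> [[+ ?] gj]; rewrite X_step gj.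
  by move=> [? [gj ?]]; rewrite X_step gj.
have := splitE [::]; rewrite /= setIT => ->; rewrite splitE.
rewrite ge0_sume_distrl; last by move=> j _; rewrite mule_ge0// lee_fin.
by apply: eq_bigr => j _; rewrite expr1 -muleA -EFinM -exprS.
Qed.

(** On the event that [gamma k] equals [j] the new state is [G j (X k w)], and
    this event is independent of [X k] with probability [J%:R^-1]. *)
Lemma integral_chain_step k (phi : U -> R) :
  (forall x, 0 <= phi x) ->
  (forall B, measurable B -> M (phi @^-1` B)) ->
  (\int[P]_w (phi (X k.+1 w))%:E =
   \int[P]_w (J%:R^-1 * \sum_(j < J) phi (G j (X k w)))%:E)%E.
Proof.
move=> phi_ge0 phi_meas.
have mstate l (psi : U -> R) : (forall B, measurable B -> M (psi @^-1` B)) ->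
    measurable_fun setT (fun w => psi (X l w)).
  move=> mpsi _ B mB; rewrite setTI.
  exact: (state_measurable l _ (mpsi _ mB)).
have mG j : measurable_fun setT (fun w => phi (G j (X k w))).
  by apply: (mstate k (fun x => phi (G j x))) => B /phi_meas; exact: M_preimage.
transitivity (\sum_(j < J) (J%:R^-1)%:E * \int[P]_w (phi (G j (X k w)))%:E)%E.
  rewrite [in LHS](index_partition setT k) ge0_integral_bigsetU//; last first.
  - by move=> w _; rewrite lee_fin.
  - rewrite -index_partition; apply/measurable_EFinP; exact: mstate.
  - exact: index_trivIset.
  - exact: index_enum_uniq.
  - by move=> j; rewrite setTI; exact: index_measurable.
  apply: eq_bigr => j _; rewrite setTI.
  rewrite (eq_integral (fun w => (phi (G j (X k w)))%:E)); last first.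
    by move=> w; rewrite inE/= => gj; rewrite X_step gj.
  apply: integral_independent_event => //; first exact: index_measurable.
  move=> B mB; have := @state_cylinder_independent k _ [:: j]
    (M_preimage j _ (phi_meas _ mB)).
  by rewrite /= setIT expr1.
transitivity (\sum_(j < J)
    \int[P]_w ((J%:R^-1)%:E * (phi (G j (X k w)))%:E))%E.
  apply: eq_bigr => j _; rewrite ge0_integralZl_EFin ?invr_ge0//.
  - by move=> w _; rewrite lee_fin.
  - exact/measurable_EFinP.
rewrite -ge0_integral_sum//; last first.
- by move=> j w _; rewrite -EFinM lee_fin mulr_ge0.
- by move=> j; apply/measurable_EFinP; apply: measurable_funM.
by apply: eq_integral => w _; rewrite mulr_sumr -sumEFin.
Qed.
End DrivenChain.

(** * The quadratic recursion *)

Section QuadraticRecursion.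
Context {R : realType}.
Variables (eta lam0 Lam D0 : R).
Hypotheses (eta_gt0 : 0 < eta) (lam0_gt0 : 0 < lam0).
Hypotheses (Lam_ge0 : 0 <= Lam) (D0_ge0 : 0 <= D0).

Let z0 := z_zero eta lam0 Lam D0.
Let disc := 4 * eta ^+ 2 * Lam ^+ 2 * D0 ^+ 2 + 8 * eta * lam0 * D0 ^+ 2.

Let eLD_ge0 : 0 <= eta * Lam * D0.
Proof. by rewrite !mulr_ge0// ltW. Qed.

Let disc_ge : (2 * (eta * Lam * D0)) ^+ 2 <= disc.
Proof.
rewrite /disc (_ : _ ^+ 2 = 4 * eta ^+ 2 * Lam ^+ 2 * D0 ^+ 2); last by ring.
by rewrite lerDl !mulr_ge0 ?exprn_ge0// ltW.
Qed.

Let z_zeroE : 4 * lam0 * z0 = - 2 * (eta * Lam * D0) + Num.sqrt disc.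
Proof. by rewrite /z0 /z_zero -/disc; field; rewrite gt_eqF. Qed.

Lemma z_zero_ge0 : 0 <= z0.
Proof.
have := ler_wsqrtr disc_ge; rewrite sqrtr_sqr => le_s.
have {}le_s := le_trans (ler_norm _) le_s.
have : 0 <= 4 * lam0 * z0 by rewrite z_zeroE; lra.
by rewrite pmulr_rge0// mulr_gt0.
Qed.

Lemma z_zero_root :
  2 * lam0 * z0 ^+ 2 + 2 * (eta * Lam * D0) * z0 = eta * D0 ^+ 2.
Proof.
have := sqr_sqrtr (le_trans (sqr_ge0 _) disc_ge).
have -> : Num.sqrt disc = 4 * lam0 * z0 + 2 * (eta * Lam * D0).
  by rewrite z_zeroE; ring.
rewrite /disc => sq.
have l8 : 8 * lam0 != 0 by rewrite mulf_neq0 ?gt_eqF// ltr0n.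
by apply: (mulfI l8); move: sq; rewrite -/z0; lra.
Qed.

Hypothesis contraction : 0 < 1 - 2 * eta * lam0.
Hypothesis z0_large : eta ^+ 2 * Lam * D0 / (1 - 2 * eta * lam0) <= z0.

(** Since [m <= s] for [s := Num.sqrt r], the hypothesis on [r'] implies
    [h s <= r'], where [h s = a * s ^+ 2 - 2 * b * s + c] with
    [a = 1 - 2 * eta * lam0], [b = eta ^+ 2 * Lam * D0] and
    [c = eta ^+ 2 * D0 ^+ 2].  By [z_zero_root], [h z0 = z0 ^+ 2], and [h s]
    exceeds [s ^+ 2] for smaller [s]; [z0_large] puts [z0] to the right of the
    vertex [b / a] of [h], so that [h s >= h z0] for larger [s]. *)
Lemma quadratic_step (r r' m : R) :
  0 <= m -> m ^+ 2 <= r ->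
  (1 - 2 * eta * lam0) * r + eta ^+ 2 * D0 ^+ 2
    <= r' + 2 * (eta ^+ 2 * Lam * D0) * m ->
  (r < z0 ^+ 2 -> r < r') /\ (z0 ^+ 2 <= r -> z0 ^+ 2 <= r').
Proof.
move=> m_ge0 m_le; have r_ge0 : 0 <= r by exact: le_trans (sqr_ge0 _) m_le.
have z_ge0 := z_zero_ge0; have root := z_zero_root.
set s := Num.sqrt r; have s_ge0 : 0 <= s by exact: sqrtr_ge0.
have rE : r = s ^+ 2 by rewrite sqr_sqrtr.
have m_le_s : m <= s by rewrite -(ler_pXn2r (n := 2)) ?nnegrE// -rE.
have b_ge0 : 0 <= eta ^+ 2 * Lam * D0 by rewrite !mulr_ge0// ltW.
move: z0_large; rewrite ler_pdivrMr// => vertex.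
rewrite {}rE => low; have {}low : (1 - 2 * eta * lam0) * s ^+ 2
    + eta ^+ 2 * D0 ^+ 2 <= r' + 2 * (eta ^+ 2 * Lam * D0) * s.
  by apply: le_trans low _; rewrite lerD2l ler_wpM2l// mulr_ge0.
have eroot : eta * (2 * lam0 * z0 ^+ 2 + 2 * (eta * Lam * D0) * z0)
    = eta * (eta * D0 ^+ 2) by rewrite root.
split.
  rewrite ltr_pXn2r ?nnegrE// => s_lt.
  (* [h s - s ^+ 2], with the root equation subtracted, is [gap + gap'] *)
  have gap : 0 < eta * (2 * lam0) * (z0 ^+ 2 - s ^+ 2).
    by rewrite !mulr_gt0 ?subr_gt0 ?ltr_pXn2r ?nnegrE.
  have gap' : 0 <= 2 * (eta ^+ 2 * Lam * D0) * (z0 - s).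
    by apply: mulr_ge0; [exact: mulr_ge0|rewrite subr_ge0 ltW].
  lra.
rewrite ler_pXn2r ?nnegrE// => s_ge.
(* this product is [h s - h z0] *)
have mono : 0 <= (s - z0) *
    ((1 - 2 * eta * lam0) * (s + z0) - 2 * (eta ^+ 2 * Lam * D0)).
  rewrite mulr_ge0 ?subr_ge0//.
  by have := ler_wpM2l (ltW contraction) s_ge; lra.
lra.
Qed.
End QuadraticRecursion.

(** * Moments *)

Section Moments.
Context {disp : measure_display} {T : measurableType disp} {R : realType}.
Variable P : probability T R.
Variable Y : T -> R.
Hypotheses (mY : measurable_fun setT Y) (Y_ge0 : forall w, 0 <= Y w).

Let mY2 : measurable_fun setT (fun w => Y w ^+ 2).
Proof. exact: measurable_funX. Qed.

Lemma integrable_square :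
  (\int[P]_w (Y w ^+ 2)%:E < +oo)%E ->
  P.-integrable setT (fun w => (Y w ^+ 2)%:E).
Proof.
move=> Y2_fin; apply/integrableP; split; first exact/measurable_EFinP.
rewrite (eq_integral (fun w => (Y w ^+ 2)%:E))// => w _.
by rewrite gee0_abs// lee_fin sqr_ge0.
Qed.

Lemma integrable_le_affine_square (S : T -> R) (A B : R) :
  measurable_fun setT S -> (forall w, 0 <= S w) ->
  P.-integrable setT (fun w => (Y w ^+ 2)%:E) ->
  (forall w, S w <= A * Y w ^+ 2 + B) ->
  P.-integrable setT (fun w => (S w)%:E).
Proof.
move=> mS S_ge0 iY2 S_le.
apply: (@le_integrable _ _ _ P setT measurableT _
  (fun w => (A%:E * (Y w ^+ 2)%:E + B%:E)%E)) => //.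
- exact/measurable_EFinP.
- move=> w _; rewrite -EFinM -EFinD /= lee_fin ger0_norm//.
  exact: le_trans (S_le w) (ler_norm _).
- apply: integrableD => //; first exact: integrableZl.
  exact: finite_measure_integrable_cst.
Qed.

(** The witness is the first moment of [Y], and the bound on its square is the
    nonnegativity of the variance. *)
Lemma first_moment_bound (S : T -> R) (a b c : R) :
  P.-integrable setT (fun w => (Y w ^+ 2)%:E) ->
  P.-integrable setT (fun w => (S w)%:E) ->
  (forall w, a * Y w ^+ 2 + c <= S w + b * Y w) ->
  exists m : R, [/\ 0 <= m, m ^+ 2 <= \int[P]_w (Y w ^+ 2) &
    a * (\int[P]_w (Y w ^+ 2)) + c <= \int[P]_w (S w) + b * m].
Proof.
move=> iY2 iS low.
have icst x : P.-integrable setT (EFin \o cst x).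
  exact: finite_measure_integrable_cst.
have iY : P.-integrable setT (EFin \o Y).
  apply: (@integrable_le_affine_square _ 1 1) => // w.
  by have := sqr_ge0 (Y w - 1); nra.
have iZ (x : R) (f : T -> R) : P.-integrable setT (EFin \o f) ->
    P.-integrable setT (EFin \o (fun w => x * f w)).
  by move=> if_; exact: (integrableZl _ x if_).
have iD (f g : T -> R) : P.-integrable setT (EFin \o f) ->
    P.-integrable setT (EFin \o g) ->
    P.-integrable setT (EFin \o (fun w => f w + g w)).
  by move=> if_ ig; exact: (integrableD _ if_ ig).
have cstE x : \int[P]_w cst x w = x.
  rewrite Rintegral_cst// -[RHS]mulr1; congr (_ * _).
  by transitivity (fine (P setT)) => //; rewrite probability_setT.
exists (\int[P]_w Y w); set m := \int[P]_w Y w; split.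
- by apply: Rintegral_ge0.
- have : \int[P]_w (2 * m * Y w) <= \int[P]_w (Y w ^+ 2 + cst (m ^+ 2) w).
    apply: le_Rintegral => //; [exact: iZ|exact: iD|move=> w _ /=].
    by have := sqr_ge0 (Y w - m); nra.
  by rewrite RintegralZl// RintegralD// cstE -/m; nra.
- have : \int[P]_w (a * Y w ^+ 2 + cst c w) <= \int[P]_w (S w + b * Y w).
    by apply: le_Rintegral => //; apply: iD => //; exact: iZ.
  by rewrite !RintegralD ?RintegralZl ?cstE//; exact: iZ.
Qed.
End Moments.

(** * Borel sets of row vectors *)

Lemma continuous_borel_rV {R : realType} {n m : nat}
    (f : 'rV[R]_n -> 'rV[R]_m) : continuous f ->
  forall B, borel_rV B -> borel_rV (f @^-1` B).
Proof.
move=> /continuousP cf B mB.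
pose Tn := g_sigma_algebraType [set A : set 'rV[R]_n | open A].
pose Tm := g_sigma_algebraType [set A : set 'rV[R]_m | open A].
have mf : measurable_fun (setT : set Tn) (f : Tn -> Tm).
  apply: (@measurability _ _ Tn Tm _ _ [set A : set 'rV[R]_m | open A]) => //.
  move=> _ [A oA <-].
  by rewrite setTI; apply: sub_sigma_algebra; exact: cf.
by have := mf measurableT B mB; rewrite setTI.
Qed.

Lemma continuous_borel_real {R : realType} {n : nat} (f : 'rV[R]_n -> R) :
  continuous f -> forall B, measurable B -> borel_rV (f @^-1` B).
Proof.
move=> /continuousP cf B mB.
pose Tn := g_sigma_algebraType [set A : set 'rV[R]_n | open A].
have mf : measurable_fun (setT : set Tn) (f : Tn -> R).
  apply: (measurability _ (RGenOpens.measurableE R)) => _ [_ [a [b ->] <-]].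
  by rewrite setTI; apply: sub_sigma_algebra; exact/cf/interval_open.
by have := mf measurableT B mB; rewrite setTI.
Qed.

(** * The mean squared error of stochastic gradient descent *)

Lemma sgd_step_continuous {R : realType} {d J : nat}
    (fs : 'I_J -> 'rV[R]_d -> R) (eta lam : R) (j : 'I_J) :
  lipschitz_grad lam (fs j) -> continuous (sgd_step fs eta j).
Proof.
move=> /enorm_lipschitz_continuous grad_cont x.
apply: (cvgB (FF := nbhs_filter x) cvg_id).
exact: (cvgZr (FF := nbhs_filter x) (grad_cont x)).
Qed.

Lemma enorm_sub_continuous {R : realType} {d : nat} (theta : 'rV[R]_d) :
  continuous (fun x : 'rV[R]_d => enorm (x - theta)).
Proof.
move=> x; apply: (@continuous_comp _ _ _ (fun y : 'rV[R]_d => y - theta)).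
  exact: (cvgB (FF := nbhs_filter x) cvg_id (cvg_cst theta)).
exact: enorm_continuous.
Qed.

Theorem theorem3p4 (R : realType) (d J : nat)
    (fs : 'I_J -> 'rV[R]_d -> R) (theta_opt : 'rV[R]_d)
    (lam0 : R) (lam : 'I_J -> R) (eta : R)
    (disp : measure_display) (T : measurableType disp) (P : probability T R)
    (theta0 : T -> 'rV[R]_d) (gamma : nat -> T -> 'I_J)
    (d_ge1 : (1 <= d)%N) (J_ge1 : (1 <= J)%N)
    (fs_diff : forall j x, differentiable (fs j) x)
    (opt : global_minimizer (avg fs) theta_opt)
    (smooth : smooth_assumption fs lam0 lam)
    (theta0_meas : random_element theta0 borel_rV)
    (theta0_L2 :
      ('E_P[fun w => (enorm (theta0 w - theta_opt) ^+ 2)%R] < +oo)%E)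
    (gamma_iid : iid_uniform P gamma)
    (theta0_gamma_indep :
      independent P (sigma_of theta0 borel_rV) (sigma_seq gamma))
    (eta_gt0 : 0 < eta) (eta_lt : eta < 1 / (2 * lam0)) :
  let D0 := noise_level fs theta_opt in
  let Lam := rms lam in
  let z0 := z_zero eta lam0 Lam D0 in
  let Rk := mean_sq_error P (sgd fs eta theta0 gamma) theta_opt in
  eta ^+ 2 * Lam * D0 / (1 - 2 * eta * lam0) <= z0 ->
  [/\ forall k : nat, (mine (Rk 0%N) (z0 ^+ 2)%:E <= Rk k)%E,
      forall k : nat, (Rk k < (z0 ^+ 2)%:E)%E -> (Rk k < Rk k.+1)%E &
      forall kstar : nat, ((z0 ^+ 2)%:E <= Rk kstar)%E ->
        forall k : nat, (kstar < k)%N -> ((z0 ^+ 2)%:E <= Rk k)%E].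
Proof.
move=> D0 Lam z0 Rk z0_large.
have [lam0_gt0 lam_gt0 _ fs_lip] := smooth.
have contraction : 0 < 1 - 2 * eta * lam0.
  by move: eta_lt; rewrite ltr_pdivlMr ?mulr_gt0//; lra.
have invJ_ge0 : 0 <= J%:R^-1 :> R by rewrite invr_ge0.
pose X := sgd fs eta theta0 gamma; pose G := sgd_step fs eta.
pose Y k w := enorm (X k w - theta_opt).
pose S k w := J%:R^-1 * \sum_j enorm (G j (X k w) - theta_opt) ^+ 2.
have Y_ge0 k w : 0 <= Y k w by exact: enorm_ge0.
have G_borel j B : borel_rV B -> borel_rV (G j @^-1` B).
  by apply: continuous_borel_rV; exact: sgd_step_continuous (fs_lip j).
have X_measurable k B : borel_rV B -> measurable (X k @^-1` B).
  exact: (state_measurable P _ G _ gamma).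
have mY k : measurable_fun setT (Y k).
  move=> _ B mB; rewrite setTI; exact: (X_measurable k _
    (continuous_borel_real _ (enorm_sub_continuous theta_opt) _ mB)).
have sq_borel B : measurable B ->
    borel_rV ((fun x => enorm (x - theta_opt) ^+ 2) @^-1` B).
  apply: continuous_borel_real => x.
  apply: (@continuous_comp _ _ _ (fun x : 'rV[R]_d => enorm (x - theta_opt))
    (fun y : R => y ^+ 2)); last exact: exprn_continuous.
  exact: enorm_sub_continuous.
have mS k : measurable_fun setT (S k).
  apply: measurable_funM; first exact: measurable_cst.
  apply: measurable_sum => j _ B mB; rewrite setTI.
  exact: (X_measurable k _ (G_borel j _ (sq_borel _ mB))).
have RkE k : Rk k = (\int[P]_w (Y k w ^+ 2)%:E)%E.
  by rewrite /Rk /mean_sq_error unlock.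
have RkS k : Rk k.+1 = (\int[P]_w (S k w)%:E)%E.
  rewrite RkE (@integral_chain_step _ _ _ P _ _ borel_rV G X gamma _ _ _ _ _ k
    (fun x => enorm (x - theta_opt) ^+ 2))// => x; exact: sqr_ge0.
have iS k : P.-integrable setT (fun w => (Y k w ^+ 2)%:E) ->
    P.-integrable setT (fun w => (S k w)%:E).
  move=> iY2; apply: (integrable_le_affine_square P (Y k) (S k)
    (J%:R^-1 * \sum_j (2 + 4 * eta ^+ 2 * lam j ^+ 2))
    (J%:R^-1 * \sum_j (4 * eta ^+ 2 * enorm (grad (fs j) theta_opt) ^+ 2))) => //.
    by move=> w; rewrite mulr_ge0// sumr_ge0// => j _; exact: sqr_ge0.
  move=> w; rewrite -mulrA -mulrDr ler_wpM2l// mulr_suml -big_split/=.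
  by apply: ler_sum => j _; exact: (sgd_step_sq_upper _ _ lam0 _ _ smooth (ltW eta_gt0)).
have iY2 k : P.-integrable setT (fun w => (Y k w ^+ 2)%:E).
  elim: k => [|k IH]; apply: integrable_square => //.
    by move: theta0_L2; rewrite unlock.
  rewrite -RkE RkS; have /integrableP[_] := iS _ IH.
  rewrite (eq_integral (fun w => (S k w)%:E))// => w _.
  rewrite gee0_abs// lee_fin mulr_ge0// sumr_ge0// => j _; exact: sqr_ge0.
(* the errors are finite, so the rest of the argument takes place in [R] *)
pose r k := \int[P]_w (Y k w ^+ 2).
have RkrE k : Rk k = (r k)%:E.
  by rewrite RkE /r /Rintegral fineK//; exact: integrable_fin_num.
have rS k : r k.+1 = \int[P]_w (S k w).
  by rewrite /Rintegral -RkS RkrE.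
have step k : (r k < z0 ^+ 2 -> r k < r k.+1) /\
    (z0 ^+ 2 <= r k -> z0 ^+ 2 <= r k.+1).
  have [|m [m_ge0 m_le low]] := first_moment_bound P (Y k) (mY k) (Y_ge0 k)
    (S k) (1 - 2 * eta * lam0) (2 * (eta ^+ 2 * Lam * D0))
    (eta ^+ 2 * D0 ^+ 2) (iY2 k) (iS k (iY2 k)).
    move=> w.
    have low : (1 - 2 * eta * lam0) * Y k w ^+ 2 - 2 * eta ^+ 2 * Lam * D0 * Y k w
        + eta ^+ 2 * D0 ^+ 2 <= S k w.
      exact: (sgd_step_mean_sq_lower fs theta_opt lam0 lam eta J_ge1 fs_diff opt
        smooth (ltW eta_gt0) (X k w)).
    lra.
  apply: (quadratic_step _ _ _ _ eta_gt0 lam0_gt0 _ _ contraction z0_large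
    _ _ m) => //; [exact: sqrtr_ge0|exact: sqrtr_ge0|by rewrite rS].
split.
- elim=> [|k]; first by rewrite ge_min lexx.
  rewrite !RkrE !ge_min !lee_fin.
  have [lt_z|ge_z] := ltP (r k) (z0 ^+ 2); last by rewrite ((step k).2 ge_z) !orbT.
  by rewrite orbF => le0k; rewrite (le_trans le0k)// ltW// (step k).1.
- by move=> k; rewrite !RkrE !lte_fin; exact: (step k).1.
- move=> kstar; rewrite RkrE lee_fin => ge_z.
  elim=> // k IH; rewrite ltnS leq_eqVlt RkrE lee_fin => /predU1P[<-|/IH].
    exact: (step kstar).2.
  by rewrite RkrE lee_fin; exact: (step k).2.
Qed.
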